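(* Fix $C,c,\varepsilon>0$. Let $\mu$ be a probability measure on $\mathbb{C}$ supported on $B(0,C)$, and assume $|m_\mu(z)|\ge c$ for all $z\in\Gamma$, where $\Gamma$ is the boundary of $B(0,C+\varepsilon)$. Then for any function $\varphi$ (possibly depending on $n$), analytic in a neighborhood containing the closure of $B(0,C+\varepsilon)$, one has $$\sum_{j=1}^{n-1}\varphi(w_j^{(n)})=\sum_{i=1}^n\varphi(X_i)+O\left(\oint_\Gamma|\varphi(z)|\,|dz|\right),$$ where $w_1^{(n)},\ldots,w_{n-1}^{(n)}$ are the critical points of the polynomial $p_n(z):=\prod_{i=1}^n(z-X_i)$ and $X_1,\ldots,X_n$ are iid random variables with distribution $\mu$. Here, the implicit constants in the asymptotic notation depend on $C$, $c$, and $\varepsilon$.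
   Context: $B(z_0,r)=\{z\in\mathbb{C}:|z-z_0|<r\}$. The Cauchy--Stieltjes transform of $\mu$ is $m_\mu(z):=\int_{\mathbb{C}}\frac{d\mu(x)}{z-x}$, defined for those $z\in\mathbb{C}$ for which the integral exists. Critical points are listed with multiplicity. Asymptotic notation is as $n\to\infty$: $X_n=O(Y_n)$ means $|X_n|\le KY_n$ for some constant $K>0$ and all $n>K$. *)

(* Defs.v *)
From HB Require Import structures.
From mathcomp Require Import all_boot all_order all_algebra.
From mathcomp Require Import complex.
From mathcomp Require Import all_classical all_reals all_analysis.

Set Implicit Arguments.
Unset Strict Implicit.
Unset Printing Implicit Defensive.

Import Order.TTheory GRing.Theory Num.Theory.
Import numFieldNormedType.Exports.

Local Open Scope classical_set_scope.
Local Open Scope ring_scope.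
Local Open Scope complex_scope.

(* The norm of R[i] takes its values in R[i], ordered by                      *)
(* x <= y <-> Im x = Im y /\ Re x <= Re y; real bounds are written r%:C and   *)
(* the disc B(z0, r) is the library's  ball z0 r%:C.                          *)
HB.instance Definition _ (R : rcfType) := NormedModule.copy R[i] R[i]^o.

Section borel.
Variable R : realType.

(* Borel sigma-algebra of the complex plane *)
HB.instance Definition _ := @isMeasurable.Build default_measure_display R[i]
  <<s open >> (@sigma_algebra0 _ setT open)
  (@sigma_algebraC _ open) (@sigma_algebra_bigcup _ setT open).

End borel.

Definition boundary (T : topologicalType) (A : set T) : set T :=
  closure A `\` A°.

Section complex_analysis.
Variable R : realType.
Implicit Types (f phi : R[i] -> R[i]) (z : R[i]) (U A : set R[i]).

Definition analytic_at f z0 : Prop :=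
  exists a : nat -> R[i], \forall z \near z0,
    series (fun k => a k * (z - z0) ^+ k) @ \oo --> f z.

(* f is analytic in some open neighborhood of A *)
Definition analytic_near A f : Prop :=
  exists U, [/\ open U, A `<=` U & forall z, U z -> analytic_at f z].

(* The point r * e ^ (i t) *)
Definition circle_point (r t : R) : R[i] := (r * cos t) +i* (r * sin t).

(* The arc-length integral of |f(z)| |dz| over the circle |z| = r, through    *)
(* z = r * e ^ (i t), for which |dz| = r dt                                   *)
Definition circle_abs_integral (r : R) f : R :=
  \int[lebesgue_measure]_(t in `[0, 2 * pi])
    (ComplexField.Normc.normc (f (circle_point r t)) * r).

(* The junk value 0^-1 = 0 at x = z is irrelevant off the support of mu,      *)
(* where the integrand is bounded away from its singularity.                  *)
Definition cauchy_stieltjes (mu : probability R[i] R) (z : R[i]) : R[i] :=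
  (\int[mu]_x complex.Re (z - x)^-1) +i* (\int[mu]_x complex.Im (z - x)^-1).

(* The roots of p' with multiplicity, for p' <> 0 *)
Definition critical_points (p : {poly R[i]}) : seq R[i] :=
  sval (closed_field_poly_normal p^`()).

End complex_analysis.

Section iid.
Context {d d' : measure_display} {T : measurableType d} {T' : measurableType d'}.
Context {R : realType} (P : probability T R).

Definition mutually_independent (X : nat -> {RV P >-> T'}) : Prop :=
  forall (J : seq nat) (A : nat -> set T'), uniq J ->
    (forall i, measurable (A i)) ->
    P (\bigcap_(i in [set` J]) (X i @^-1` A i)) =
    (\prod_(i <- J) P (X i @^-1` A i))%E.

Definition iid_with_law (mu : probability T' R)
    (X : nat -> {RV P >-> T'}) : Prop :=
  mutually_independent X /\
  forall i (A : set T'), measurable A -> distribution P (X i) A = mu A.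

End iid.

(* Main.v *)
Require Import Defs.
From HB Require Import structures.
From mathcomp Require Import all_boot all_order all_algebra.
From mathcomp Require Import complex ring lra.
From mathcomp Require Import all_classical all_reals all_analysis.

(* If all X_i lie in B(0, C) then, for z on the circle |z| = r := C + eps, each
   z / (z - X_i) has real part at least 1/2, so A(z) := \sum_i 1 / (z - X_i)
   satisfies |A(z)| >= n / (2 r). The same inequality confines the critical
   points w_j to B(0, C) (Gauss-Lucas). From p' = A p one gets
   \sum_j 1 / (z - w_j) - A(z) = A'(z) / A(z), which is bounded by 2 r / eps^2.
   Cauchy's formula on the circle writes \sum_j phi(w_j) - \sum_i phi(X_i) as
   the integral of phi A' / A over 2 pi i, whence the bound for every n > 0.
   Cauchy's formula is proved by contracting the circle to a point and
   differentiating under the integral sign; only its real part is needed, since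
   |S| = Re (u S) for some unimodular u. *)

Import Order.TTheory GRing.Theory Num.Theory.
Import numFieldNormedType.Exports.

Set Implicit Arguments.
Unset Strict Implicit.

Local Open Scope classical_set_scope.
Local Open Scope ring_scope.
Local Open Scope complex_scope.

Local Notation normc := ComplexField.Normc.normc.
Local Notation Re := complex.Re.
Local Notation Im := complex.Im.

(** * Complex numbers *)

Section modulus.
Variable R : realType.
Implicit Types (x y z w : R[i]) (r : R).

Lemma normr_normc x : `|x| = (normc x)%:C.
Proof. by []. Qed.

Lemma normc_ge0 x : 0 <= normc x.
Proof. by rewrite -lecR -normr_normc normr_ge0. Qed.

Lemma normcB_le x y : normc (x - y) <= normc x + normc y.
Proof. by rewrite -lecR rmorphD /= -!normr_normc ler_normB. Qed.

Lemma normc_distC x y : normc (x - y) = normc (y - x).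
Proof. by rewrite -normcN opprB. Qed.

Lemma normcXn x n : normc (x ^+ n) = normc x ^+ n.
Proof. by apply: complexI; rewrite rmorphXn /= -!normr_normc normrX. Qed.

Lemma normc_real r : normc r%:C = `|r|.
Proof. by rewrite /= expr0n addr0 sqrtr_sqr. Qed.

Lemma normc_eq0 x : (normc x == 0) = (x == 0).
Proof. by rewrite -(inj_eq (@complexI R)) -normr_normc normr_eq0. Qed.

Lemma normc_gt0 x : (0 < normc x) = (x != 0).
Proof. by rewrite lt0r normc_eq0 normc_ge0 andbT. Qed.

Lemma normcJ_eq x : normc (conjc x) = normc x.
Proof. by apply: complexI; rewrite -!normr_normc normcJ. Qed.

Lemma normc_sum (I : Type) (s : seq I) (F : I -> R[i]) :
  normc (\sum_(i <- s) F i) <= \sum_(i <- s) normc (F i).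
Proof.
elim/big_rec2 : _ => [|i y x _ le_xy]; first by rewrite ComplexField.Normc.normc0.
exact: le_trans (le_normcD _ _) (lerD _ _).
Qed.

Lemma sqr_normcE x : normc x ^+ 2 = Re x ^+ 2 + Im x ^+ 2.
Proof. by case: x => a b /=; rewrite sqr_sqrtr// addr_ge0 ?sqr_ge0. Qed.

Lemma normRe_le x : `|Re x| <= normc x.
Proof.
rewrite -(ler_pXn2r (n := 2)) ?nnegrE ?normc_ge0// sqr_normcE real_normK ?num_real//.
by rewrite lerDl sqr_ge0.
Qed.

Lemma normIm_le x : `|Im x| <= normc x.
Proof.
rewrite -(ler_pXn2r (n := 2)) ?nnegrE ?normc_ge0// sqr_normcE real_normK ?num_real//.
by rewrite lerDr sqr_ge0.
Qed.

Lemma Re_le_normc x : Re x <= normc x.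
Proof. exact: le_trans (ler_norm _) (normRe_le x). Qed.

Lemma normc_le_ReIm x : normc x <= `|Re x| + `|Im x|.
Proof.
rewrite -(ler_pXn2r (n := 2)) ?nnegrE ?normc_ge0 ?addr_ge0// sqr_normcE.
rewrite sqrrD !real_normK ?num_real// -addrA [X in _ <= _ + X]addrC.
by rewrite lerD2l lerDl mulrn_wge0 // mulr_ge0.
Qed.

Lemma ReD x y : Re (x + y) = Re x + Re y. Proof. by case: x y => [? ?] []. Qed.
Lemma ImD x y : Im (x + y) = Im x + Im y. Proof. by case: x y => [? ?] []. Qed.
Lemma ReN x : Re (- x) = - Re x. Proof. by case: x. Qed.
Lemma ImN x : Im (- x) = - Im x. Proof. by case: x. Qed.
Lemma ReM x y : Re (x * y) = Re x * Re y - Im x * Im y.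
Proof. by case: x y => [? ?] []. Qed.
Lemma ImM x y : Im (x * y) = Re x * Im y + Im x * Re y.
Proof. by case: x y => [? ?] []. Qed.
Lemma ReRM r x : Re (r%:C * x) = r * Re x.
Proof. by rewrite ReM /= mul0r subr0. Qed.
Lemma ImRM r x : Im (r%:C * x) = r * Im x.
Proof. by rewrite ImM /= mul0r addr0. Qed.

Lemma Re_sum (I : Type) (s : seq I) (F : I -> R[i]) :
  Re (\sum_(i <- s) F i) = \sum_(i <- s) Re (F i).
Proof. by elim/big_rec2 : _ => // i y x _ <-; rewrite ReD. Qed.
Lemma Im_sum (I : Type) (s : seq I) (F : I -> R[i]) :
  Im (\sum_(i <- s) F i) = \sum_(i <- s) Im (F i).
Proof. by elim/big_rec2 : _ => // i y x _ <-; rewrite ImD. Qed.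

(** Take [u] to be the conjugate of [x] divided by its modulus, or 1 when [x] is 0. *)
Lemma exists_unimodular x : exists2 u, normc u = 1 & normc x = Re (u * x).
Proof.
have [->|x0] := eqVneq x 0.
  by exists 1; rewrite ?mulr0 ?ComplexField.Normc.normc0 ?ComplexField.Normc.normc1.
have nx0 : normc x != 0 by rewrite normc_eq0.
exists ((normc x)^-1%:C * conjc x).
  rewrite ComplexField.Normc.normcM normcJ_eq normc_real ger0_norm ?invr_ge0 ?normc_ge0//.
  by rewrite mulVf.
rewrite -mulrA ReRM; have -> : Re (conjc x * x) = normc x ^+ 2.
  by rewrite sqr_normcE; case: (x) => a b; rewrite ReM /=; ring.
by rewrite expr2 mulKf.
Qed.

End modulus.

(** * Neighbourhoods and limits in the complex plane through real radii *)

Section convergence.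
Variable R : realType.
Implicit Types (x y z w : R[i]) (r : R).

Lemma ball_normc x r y : ball x r%:C y = (normc (x - y) < r) :> Prop.
Proof. by rewrite -ball_normE /ball_ /= normr_normc ltcR. Qed.

(** In the order of [R[i]] positive elements are real, so every complex radius or tolerance comes
    from a real one. *)
Lemma gt0_complexP (e : R[i]) : 0 < e -> exists2 r : R, 0 < r & e = r%:C.
Proof.
by case: e => a b; rewrite ltcE /= => /andP[/eqP-> a0]; exists a.
Qed.

Lemma nbhs_normcP x (A : set R[i]) :
  nbhs x A <-> exists2 r : R, 0 < r & forall y, normc (y - x) < r -> A y.
Proof.
split.
  move=> /nbhs_ballP[e /= /gt0_complexP[r r0 ->] xA]; exists r => // y yx.
  by apply: xA; rewrite ball_normc normc_distC.
move=> [r r0 xA]; apply/nbhs_ballP; exists r%:C => /=; first by rewrite ltcR.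
by move=> y; rewrite ball_normc normc_distC; exact: xA.
Qed.

Lemma cvg_normcP (T : Type) (F : set_system T) {FF : Filter F} (u : T -> R[i]) x :
  u @ F --> x <-> forall e : R, 0 < e -> \forall n \near F, normc (u n - x) < e.
Proof.
split.
  move=> /cvgrPdist_lt ux e e0.
  have /ux : 0 < e%:C by rewrite ltcR.
  by apply: filterS => n /=; rewrite normr_normc ltcR normc_distC.
move=> ux; apply/cvgrPdist_lt => e /gt0_complexP[r /ux + ->].
by apply: filterS => n /=; rewrite normr_normc ltcR normc_distC.
Qed.

End convergence.

(** * Complex differentiability and power series *)

Section differentiability.
Variable R : realType.
Implicit Types (x y z w : R[i]) (r s t e : R) (f g : R[i] -> R[i]).

(* Complex differentiability near z0 with a uniform quadratic remainder:
   exchanging z and w shows that f' is then Lipschitz at z0, so its continuity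
   needs no separate argument. *)
Definition quad_diff f f' z0 := exists d M : R, [/\ 0 < d, 0 <= M &
  forall z w, normc (z - z0) < d -> normc (w - z0) < d ->
    normc (f w - f z - f' z * (w - z)) <= M * normc (w - z) ^+ 2].

Lemma quad_diff_lipschitz f f' z0 : quad_diff f f' z0 ->
  exists d M : R, [/\ 0 < d, 0 <= M & forall w, normc (w - z0) < d ->
    normc (f' w - f' z0) <= M * normc (w - z0)].
Proof.
move=> [d [M [d0 M0 fM]]]; exists d, (2 * M); split; [by []|by rewrite mulr_ge0|].
move=> w wd; have [->|wz0] := eqVneq w z0.
  by rewrite !subrr ComplexField.Normc.normc0 mulr0.
have z0d : normc (z0 - z0) < d by rewrite subrr ComplexField.Normc.normc0.
have wz0' : 0 < normc (w - z0) by rewrite normc_gt0 subr_eq0.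
rewrite -(ler_pM2r wz0') -ComplexField.Normc.normcM.
(* Adding the remainder from [z0] to [w] to the one from [w] to [z0] cancels [f] and leaves
   [(f' w - f' z0) * (w - z0)]. *)
rewrite [X in normc X](_ : _ =
   (f w - f z0 - f' z0 * (w - z0)) + (f z0 - f w - f' w * (z0 - w))); last ring.
apply: le_trans (le_normcD _ _) _.
have h1 := fM _ _ z0d wd; have h2 := fM _ _ wd z0d.
rewrite [normc (z0 - w)]normc_distC in h2.
by apply: le_trans (lerD h1 h2) _; rewrite le_eqVlt; apply/orP; left; apply/eqP; ring.
Qed.

Lemma quad_diff_derivative_continuous f f' z0 : quad_diff f f' z0 ->
  f' w @[w --> z0] --> f' z0.
Proof.
move=> /quad_diff_lipschitz[d [M [d0 M0 fM]]].
apply/(cvg_normcP (F := nbhs z0)) => e e0; apply/nbhs_normcP.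
exists (Num.min d (e / (M + 1))).
  by rewrite lt_min d0 divr_gt0// ltr_wpDl.
move=> w; rewrite lt_min => /andP[wd we].
apply: le_lt_trans (fM _ wd) _.
rewrite ltr_pdivlMr ?ltr_wpDl// in we.
apply: le_lt_trans we; rewrite mulrC ler_wpM2l ?normc_ge0//.
by rewrite lerDl.
Qed.

(** Derivative of a curve in the plane, taken componentwise so that real calculus applies to [Re]
    and [Im] separately. *)
Definition is_cderive (u : R -> R[i]) t l :=
  is_derive t 1 (fun s => Re (u s)) (Re l) /\ is_derive t 1 (fun s => Im (u s)) (Im l).

(** Multiplying the difference quotient by |h| gives a first-order remainder without division, the
    form in which the chain rule is estimated. *)
Lemma is_deriveP (u : R -> R) t l : is_derive t 1 u l <->
  forall e, 0 < e -> exists2 d, 0 < d &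
    forall h, `|h| < d -> `|u (t + h) - u t - l * h| <= e * `|h|.
Proof.
have quotE h : h != 0 ->
    `|l - h^-1 *: (u (h *: 1 + t) - u t)| * `|h| = `|u (t + h) - u t - l * h|.
  move=> h0; rewrite -normrM distrC scaler1 [h + t]addrC mulrBl.
  by rewrite [_ *: _ * _]mulrAC mulVf// mul1r.
split.
  move=> ud e e0.
  have /cvg_ex[l' ul'] : derivable u t 1 by exact: ex_derive.
  have ll' : l = l' by rewrite -(@derive_val _ _ _ _ _ _ _ ud); apply/cvg_lim.
  subst l'; move/cvgrPdist_le : ul' => /(_ _ e0)/=.
  rewrite /dnbhs /within /= => /nbhs_ballP[d /= d0 ud'].
  exists d => // h hd; have [->|h0] := eqVneq h 0.
    by rewrite addr0 subrr mulr0 subr0 normr0 mulr0.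
  have := ud' h; rewrite /ball /= sub0r normrN => /(_ hd h0).
  by rewrite -(ler_pM2r (x := `|h|)) ?normr_gt0// quotE.
move=> ud; have ul : h^-1 *: (u (h *: 1 + t) - u t) @[h --> 0^'] --> l.
  apply/cvgrPdist_le => e /ud[d d0 {}ud].
  apply/nbhs_ballP; exists d => //= h; rewrite /ball /= sub0r normrN => hd h0.
  by have := ud _ hd; rewrite -quotE// ler_pM2r ?normr_gt0.
by apply: DeriveDef; [apply/cvg_ex; exists l|apply/cvg_lim].
Qed.

Lemma is_cderiveP (u : R -> R[i]) t l : is_cderive u t l <->
  forall e, 0 < e -> exists2 d, 0 < d &
    forall h, `|h| < d -> normc (u (t + h) - u t - l * h%:C) <= e * `|h|.
Proof.
have ReE h : Re (u (t + h) - u t - l * h%:C) = Re (u (t + h)) - Re (u t) - Re l * h.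
  by rewrite !ReD !ReN [l * _]mulrC ReRM [Re l * _]mulrC.
have ImE h : Im (u (t + h) - u t - l * h%:C) = Im (u (t + h)) - Im (u t) - Im l * h.
  by rewrite !ImD !ImN [l * _]mulrC ImRM [Im l * _]mulrC.
split.
  move=> [/is_deriveP uR /is_deriveP uI] e e0.
  have e20 : 0 < e / 2 by lra.
  have [d1 d10 {}uR] := uR _ e20; have [d2 d20 {}uI] := uI _ e20.
  exists (Num.min d1 d2); first by rewrite lt_min d10.
  move=> h; rewrite lt_min => /andP[/uR hR /uI hI].
  apply: le_trans (normc_le_ReIm _) _.
  by rewrite ReE ImE; lra.
move=> ud; split; apply/is_deriveP => e /ud[d d0 {}ud]; exists d => // h /ud.
  by apply: le_trans; rewrite -ReE normRe_le.
by apply: le_trans; rewrite -ImE normIm_le.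
Qed.

Lemma is_cderive_continuous (u : R -> R[i]) t l : is_cderive u t l ->
  u s @[s --> t] --> u t.
Proof.
move=> [uR uI].
have cR : {for t, continuous (fun s => Re (u s))}.
  by apply: differentiable_continuous; apply/derivable1_diffP; apply: ex_derive.
have cI : {for t, continuous (fun s => Im (u s))}.
  by apply: differentiable_continuous; apply/derivable1_diffP; apply: ex_derive.
apply/cvg_normcP => e e0.
have e20 : 0 < e / 2 by lra.
move/cvgrPdist_lt : cR => /(_ _ e20); move/cvgrPdist_lt : cI => /(_ _ e20).
apply: filterS2 => s hI hR; apply: le_lt_trans (normc_le_ReIm _) _.
by rewrite !ReD !ImD !ReN !ImN distrC [in X in _ + X]distrC; lra.
Qed.

(** The remainder splits into the quadratic remainder of [f] along [u] and [f' (u t)] times the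
    first-order remainder of [u]; each part gets half of the tolerance. *)
Lemma is_cderive_comp f f' (u : R -> R[i]) t l :
  quad_diff f f' (u t) -> is_cderive u t l ->
  is_cderive (fun s => f (u s)) t (f' (u t) * l).
Proof.
move=> [d [M [d0 M0 fM]]] ul; apply/is_cderiveP => e e0.
have uc := is_cderive_continuous ul.
move/cvg_normcP : (uc) => /(_ _ d0)/nbhs_ballP[d1 /= d10 ud1].
set B := normc (f' (u t)); set L := normc l.
have B0 : 0 <= B by exact: normc_ge0.
have L0 : 0 <= L by exact: normc_ge0.
have e10 : 0 < e / (2 * (B + 1)) by rewrite divr_gt0// mulr_gt0// ltr_wpDl.
move/is_cderiveP : ul => ul; have [d2 d20 ul2] := ul _ e10.
(* Tolerance 1 already bounds the increment of [u] by (L + 1) |h|; below [d4] the quadratic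
   remainder is then at most e / 2 |h|. *)
have [d3 d30 ul3] := ul _ ltr01.
set d4 := e / (2 * (M + 1) * (L + 1) ^+ 2).
have L1 : 0 < L + 1 by rewrite ltr_wpDl.
have M1 : 0 < M + 1 by rewrite ltr_wpDl.
have d40 : 0 < d4 by rewrite divr_gt0// mulr_gt0 ?mulr_gt0 ?exprn_gt0.
exists (Num.min (Num.min d1 d2) (Num.min d3 d4)).
  by rewrite !lt_min d10 d20 d30 d40.
move=> h; rewrite !lt_min => /andP[/andP[h1 h2] /andP[h3 h4]].
have {}ul2 := ul2 _ h2; have {}ul3 := ul3 _ h3; rewrite mul1r in ul3.
have uth : normc (u (t + h) - u t) < d.
  by apply: ud1; rewrite /ball /= opprD addNKr normrN.
have utt : normc (u t - u t) < d by rewrite subrr ComplexField.Normc.normc0.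
have {}fM := fM _ _ utt uth.
have uL : normc (u (t + h) - u t) <= (L + 1) * `|h|.
  rewrite -[u (t + h) - u t](subrK (l * h%:C)).
  apply: le_trans (le_normcD _ _) _.
  by rewrite ComplexField.Normc.normcM normc_real mulrDl mul1r addrC lerD2l.
rewrite [X in normc X](_ : _ =
  (f (u (t + h)) - f (u t) - f' (u t) * (u (t + h) - u t)) +
  f' (u t) * (u (t + h) - u t - l * h%:C)); last ring.
apply: le_trans (le_normcD _ _) _.
have e2 : e * `|h| = e / 2 * `|h| + e / 2 * `|h| by field.
rewrite e2; apply: lerD.
  apply: le_trans fM _.
  apply: (@le_trans _ _ ((M + 1) * ((L + 1) * `|h|) ^+ 2)).
    apply: ler_pM; rewrite ?sqr_ge0 ?lerDl//.
    by rewrite ler_pXn2r ?nnegrE ?normc_ge0 ?mulr_ge0 ?(ltW L1).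
  rewrite exprMn expr2 !mulrA ler_wpM2r//.
  rewrite /d4 ltr_pdivlMr ?mulr_gt0 ?exprn_gt0// in h4.
  by rewrite ler_pdivlMr//; nra.
rewrite ComplexField.Normc.normcM -/B.
apply: (@le_trans _ _ ((B + 1) * (e / (2 * (B + 1)) * `|h|))).
  by apply: ler_pM; rewrite ?normc_ge0 ?lerDl.
rewrite mulrA ler_wpM2r// le_eqVlt; apply/orP; left; apply/eqP.
by field; rewrite lt0r_neq0// ltr_wpDl.
Qed.

Lemma quad_diff_continuous f f' z0 : quad_diff f f' z0 -> f z @[z --> z0] --> f z0.
Proof.
move=> [d [M [d0 M0 fM]]]; apply/(cvg_normcP (F := nbhs z0)) => e e0; apply/nbhs_normcP.
set B := normc (f' z0) + M + 1.
have B0 : 0 < B by rewrite ltr_wpDl// addr_ge0// normc_ge0.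
exists (Num.min (Num.min d 1) (e / B)); first by rewrite !lt_min d0 ltr01 divr_gt0.
move=> w; rewrite !lt_min => /andP[/andP[wd w1] we].
have z0d : normc (z0 - z0) < d by rewrite subrr ComplexField.Normc.normc0.
have {}fM := fM _ _ z0d wd.
rewrite -[f w - f z0](subrK (f' z0 * (w - z0))).
apply: le_lt_trans (le_normcD _ _) _; rewrite ComplexField.Normc.normcM.
rewrite ltr_pdivlMr// in we; apply: le_lt_trans we.
have n0 := normc_ge0 (w - z0).
have m0 := normc_ge0 (f' z0).
have : M * normc (w - z0) ^+ 2 <= M * normc (w - z0).
  by rewrite ler_wpM2l// expr2 ler_piMl// ltW.
by rewrite /B; nra.
Qed.

Lemma quad_diffM_const (a : R[i]) f f' z0 : quad_diff f f' z0 ->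
  quad_diff (fun z => a * f z) (fun z => a * f' z) z0.
Proof.
move=> [d [M [d0 M0 fM]]]; exists d, (normc a * M).
split; rewrite ?mulr_ge0 ?normc_ge0// => z w zd wd.
rewrite -!mulrA -!mulrBr ComplexField.Normc.normcM ler_wpM2l ?normc_ge0//.
exact: fM.
Qed.

(** The remainder is exactly b^2 (w - z)^2 / ((1 - b z)^2 (1 - b w)), so it suffices to keep 1 - b z
    away from 0. On a circle such functions are conjugates of Cauchy kernels. *)
Lemma quad_diff_inv (b z0 : R[i]) : 1 - b * z0 != 0 ->
  quad_diff (fun z => (1 - b * z)^-1) (fun z => b * (1 - b * z)^-1 ^+ 2) z0.
Proof.
move=> bz0; set n := normc (1 - b * z0).
have n0 : 0 < n by rewrite normc_gt0.
set B := normc b; have B0 : 0 <= B := normc_ge0 b.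
have lowB z : normc (z - z0) < n / (2 * (B + 1)) -> n / 2 <= normc (1 - b * z).
  move=> zd; rewrite ltr_pdivlMr ?mulr_gt0 ?ltr_wpDl// in zd.
  have : n <= normc (1 - b * z) + normc (b * (z - z0)).
    by rewrite /n; apply: le_trans (le_normcD _ _); rewrite le_eqVlt; apply/orP; left;
      apply/eqP; congr normc; ring.
  rewrite ComplexField.Normc.normcM -/B.
  have := normc_ge0 (z - z0); nra.
exists (n / (2 * (B + 1))), (B ^+ 2 * (2 / n) ^+ 3); split.
- by rewrite divr_gt0// mulr_gt0// ltr_wpDl.
- by rewrite mulr_ge0 ?exprn_ge0// divr_ge0// ltW.
move=> z w /lowB zb /lowB wb.
have n20 : 0 < n / 2 by rewrite divr_gt0.
have z0' : 1 - b * z != 0 by rewrite -normc_gt0; exact: lt_le_trans zb.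
have w0' : 1 - b * w != 0 by rewrite -normc_gt0; exact: lt_le_trans wb.
rewrite [X in normc X](_ : _ = b ^+ 2 * ((1 - b * z)^-1 ^+ 2 * (1 - b * w)^-1) * (w - z) ^+ 2); last first.
  by field; rewrite w0'.
rewrite (ComplexField.Normc.normcM _ ((w - z) ^+ 2)) (ComplexField.Normc.normcM (b ^+ 2)).
rewrite (ComplexField.Normc.normcM (_ ^-1 ^+ 2)) !normcXn -/B ler_wpM2r ?sqr_ge0//.
rewrite ler_wpM2l ?sqr_ge0// !ComplexField.Normc.normcV [X in _ <= X]exprSr.
have -> : 2 / n = (n / 2)^-1 by rewrite invf_div.
apply: ler_pM; rewrite ?exprn_ge0 ?invr_ge0 ?normc_ge0//.
  by rewrite ler_pXn2r ?nnegrE ?invr_ge0 ?normc_ge0 ?(ltW n20)// lef_pV2// posrE ?normc_gt0.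
by rewrite lef_pV2// posrE ?normc_gt0.
Qed.

End differentiability.

(** * Analytic functions have a complex derivative with quadratic remainder *)

Section power_series.
Variable R : realType.
Implicit Types (x y z w h : R[i]) (r s t e : R) (f g : R[i] -> R[i]).

Lemma sum_geometric_half_le n : \sum_(0 <= k < n) (2^-1 : R) ^+ k <= 2.
Proof.
suff -> : \sum_(0 <= k < n) (2^-1 : R) ^+ k = 2 - 2 * 2^-1 ^+ n.
  by rewrite lerBlDr lerDl mulr_ge0// exprn_ge0// invr_ge0.
elim: n => [|n IHn]; first by rewrite big_nil expr0; lra.
by rewrite big_nat_recr//= IHn exprS; lra.
Qed.

(** Real and imaginary parts are dominated by a real geometric series, and the limit is assembled
    from theirs. *)
Lemma cvg_series_geometric_bound (u : nat -> R[i]) B :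
  (forall k, normc (u k) <= B * 2^-1 ^+ k) -> exists l : R[i], series u @ \oo --> l.
Proof.
move=> uB.
have half1 : `|(2^-1 : R)| < 1 by rewrite ger0_norm ?invr_ge0// invf_lt1// ltr1n.
have cvgB : cvgn (series (fun k => B * (2^-1 : R) ^+ k)).
  by apply: is_cvg_geometric_series.
have cvg_real (v : nat -> R) : (forall k, `|v k| <= B * 2^-1 ^+ k) -> cvgn (series v).
  move=> vB; apply: normed_cvg.
  by apply: series_le_cvg cvgB => n /=; rewrite ?vB ?(le_trans _ (vB n)) /=.
have cR : cvgn (series (fun k => Re (u k))).
  by apply: cvg_real => k; apply: le_trans (normRe_le _) (uB k).
have cI : cvgn (series (fun k => Im (u k))).
  by apply: cvg_real => k; apply: le_trans (normIm_le _) (uB k).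
exists (limn (series (fun k => Re (u k))) +i* limn (series (fun k => Im (u k)))).
apply/cvg_normcP => e e0; have e20 : 0 < e / 2 by lra.
move/cvgrPdist_lt : cR => /(_ _ e20); move/cvgrPdist_lt : cI => /(_ _ e20).
apply: filterS2 => n hI hR; apply: le_lt_trans (normc_le_ReIm _) _.
rewrite !ReD !ImD !ReN !ImN /series /= Re_sum Im_sum distrC [in X in _ + X]distrC.
by move: hI hR; rewrite /series /=; lra.
Qed.

(** Keeping [r ^+ 2] on the left avoids the exponent k - 2 and a division by [r]. The induction
    closes because k^2 + k <= (k + 1)^2. *)
Lemma exprB_quad_bound z w r k : normc z <= r -> normc w <= r ->
  r ^+ 2 * normc (w ^+ k - z ^+ k - k%:R * z ^+ k.-1 * (w - z)) <=
  k%:R ^+ 2 * r ^+ k * normc (w - z) ^+ 2.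
Proof.
move=> zr wr; have r0 : 0 <= r := le_trans (normc_ge0 z) zr.
elim: k => [|k IHk].
  by rewrite !expr0 subrr !mul0r subr0 ComplexField.Normc.normc0 mulr0 expr0n !mul0r.
(* The remainders D_k obey D_(k+1) = w D_k + k z^(k-1) (w - z)^2. *)
have -> : w ^+ k.+1 - z ^+ k.+1 - k.+1%:R * z ^+ k.+1.-1 * (w - z) =
    w * (w ^+ k - z ^+ k - k%:R * z ^+ k.-1 * (w - z)) + k%:R * z ^+ k.-1 * (w - z) ^+ 2.
  case: k {IHk} => [|k]; first by rewrite !mul0r /= !expr0 !expr1; ring.
  by rewrite /= -!natr1 !exprS; ring.
set D := _ - k%:R * _ * _ in IHk *; set n := normc (w - z).
have n0 : 0 <= n by exact: normc_ge0.
have kr0 : 0 <= k%:R * r ^+ k.+1 * n ^+ 2 by rewrite !mulr_ge0 ?exprn_ge0.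
have first : r ^+ 2 * normc (w * D) <= k%:R ^+ 2 * r ^+ k.+1 * n ^+ 2.
  rewrite ComplexField.Normc.normcM mulrCA.
  apply: le_trans (ler_pM (normc_ge0 _) _ wr IHk) _; first by rewrite mulr_ge0 ?exprn_ge0 ?normc_ge0.
  by rewrite -/n (exprS _ k) le_eqVlt; apply/orP; left; apply/eqP; ring.
have second : r ^+ 2 * normc (k%:R * z ^+ k.-1 * (w - z) ^+ 2) <= k%:R * r ^+ k.+1 * n ^+ 2.
  case: k {IHk D kr0 first} => [|k]; first by rewrite !mul0r ComplexField.Normc.normc0 mulr0.
  rewrite !(ComplexField.Normc.normcM _ (_ ^+ _)) !normcXn -/n mulrA ler_wpM2r ?sqr_ge0//=.
  have -> : normc (k.+1%:R : R[i]) = k.+1%:R.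
    by rewrite -(rmorph_nat (real_complex R)) normc_real ger0_norm.
  rewrite mulrCA ler_wpM2l// !exprS expr0 mulr1 -mulrA !ler_wpM2l//.
  by rewrite lerXn2r ?nnegrE ?normc_ge0.
rewrite -natr1; apply: le_trans (ler_wpM2l _ (le_normcD _ _)) _; first exact: sqr_ge0.
rewrite mulrDr; apply: le_trans (lerD first second) _.
have rk0 : 0 <= r ^+ k.+1 * n ^+ 2 by rewrite mulr_ge0 ?exprn_ge0.
rewrite -subr_ge0 [X in 0 <= X](_ : _ = k%:R * r ^+ k.+1 * n ^+ 2 + r ^+ k.+1 * n ^+ 2).
  exact: addr_ge0.
by ring.
Qed.

(** Once the partial sums are within 1 of the limit, a term is a difference of two of them and has
    modulus at most 2; the finitely many earlier terms are absorbed by the sum of their moduli. *)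
Lemma cvg_series_terms_bounded (u : nat -> R[i]) (l : R[i]) : series u @ \oo --> l ->
  exists2 M : R, 0 <= M & forall k, normc (u k) <= M.
Proof.
move/cvg_normcP => /(_ _ ltr01)[N _ uN].
exists (\sum_(k < N) normc (u k) + 2) => [|k].
  by rewrite addr_ge0// sumr_ge0// => k _; exact: normc_ge0.
have [Nk|kN] := leqP N k.
  have -> : u k = (series u k.+1 - l) - (series u k - l).
    by rewrite /series /= big_nat_recr//=; ring.
  apply: le_trans (normcB_le _ _) _.
  have h1 := uN _ Nk; have h2 := uN _ (leqW Nk); rewrite /= in h1 h2.
  apply: (@le_trans _ _ 2); first lra.
  by rewrite lerDr sumr_ge0// => i _; exact: normc_ge0.
rewrite (bigD1 (Ordinal kN))//= -addrA lerDl addr_ge0//.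
by rewrite sumr_ge0// => i _; exact: normc_ge0.
Qed.

(** Convergence at one point off [z0] bounds |a_k| r1^k, so on the disc of radius r1 / 8 the
    quadratic remainders of the terms are dominated by a geometric series. This bounds the remainder
    of every partial sum uniformly, and the bound passes to the limit. *)
Lemma analytic_at_quad_diff f z0 : analytic_at f z0 -> exists f', quad_diff f f' z0.
Proof.
move=> [a /nbhs_normcP[rho rho0 fa]].
set r1 := rho / 2; have r10 : 0 < r1 by rewrite divr_gt0.
have [M M0 aM] : exists2 M : R, 0 <= M & forall k, normc (a k) * r1 ^+ k <= M.
  have : normc ((z0 + r1%:C) - z0) < rho.
    by rewrite [z0 + _]addrC addrK normc_real gtr0_norm// /r1; lra.
  move=> /fa/cvg_series_terms_bounded[M M0 aM]; exists M => // k.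
  have := aM k; rewrite ComplexField.Normc.normcM normcXn [z0 + _]addrC addrK.
  by rewrite normc_real gtr0_norm.
(* The 8 is 4 times 2: the factor k^2 costs at most 4^k, and 2^-k is left for the summation. *)
set t := r1 / 8; have t0 : 0 < t by rewrite divr_gt0.
have trho : t < rho by rewrite /t /r1; lra.
have aMt k : normc (a k) * t ^+ k <= M * 8^-1 ^+ k.
  by rewrite exprMn mulrA ler_wpM2r// exprn_ge0// invr_ge0.
have k2 k : (k%:R : R) <= 2 ^+ k by rewrite -natrX ler_nat ltnW// ltn_expl.
have pow48 k : (2 : R) ^+ k ^+ 2 * 8^-1 ^+ k = 2^-1 ^+ k.
  by rewrite -exprM mulnC exprM -exprMn; congr (_ ^+ k); field.
have a1bound k : normc (a k) * k%:R * t ^+ k <= M * 2^-1 ^+ k.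
  rewrite mulrAC; apply: le_trans (ler_wpM2r _ (aMt k)) _ => //.
  rewrite -mulrA ler_wpM2l// -pow48 mulrC ler_wpM2r ?exprn_ge0 ?invr_ge0//.
  by apply: le_trans (k2 k) _; rewrite ler_eXnr ?exprn_ege1// ler1n.
have a2bound k : normc (a k) * (k%:R ^+ 2 * t ^+ k) <= M * 2^-1 ^+ k.
  rewrite mulrCA; apply: le_trans (ler_wpM2l _ (aMt k)) _; first exact: sqr_ge0.
  rewrite mulrCA ler_wpM2l// -pow48 ler_wpM2r ?exprn_ge0 ?invr_ge0//.
  by rewrite lerXn2r ?nnegrE ?exprn_ge0 ?k2.
(* [f'] is the sum of the termwise derived series on the disc of radius [t] and arbitrary
   elsewhere. *)
pose da z k := a k * (k%:R * (z - z0) ^+ k.-1).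
have /choice[f' f'E] : forall z, exists l : R[i], normc (z - z0) < t -> series (da z) @ \oo --> l.
  move=> z; have [zt|zt] := ltP (normc (z - z0)) t; last by exists 0.
  have [|l lE] := @cvg_series_geometric_bound (da z) (M / t); last by exists l.
  move=> k; rewrite mulrAC ler_pdivlMr//; apply: le_trans (a1bound k).
  rewrite !ComplexField.Normc.normcM -!mulrA ler_wpM2l ?normc_ge0//.
  case: k => [|k]; first by rewrite ComplexField.Normc.normc0 !mul0r.
  have -> : normc (k.+1%:R : R[i]) = k.+1%:R.
    by rewrite -(rmorph_nat (real_complex R)) normc_real ger0_norm.
  rewrite ler_wpM2l//= normcXn exprSr ler_wpM2r ?(ltW t0)//.
  by rewrite lerXn2r ?nnegrE ?normc_ge0 ?ltW.
have tM : 0 <= 2 * M / t ^+ 2 by rewrite divr_ge0 ?sqr_ge0 ?mulr_ge0.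
exists f', t, (2 * M / t ^+ 2); split => //.
move=> z w zt wt.
have /cvg_normcP Sz := fa _ (lt_trans zt trho).
have /cvg_normcP Sw := fa _ (lt_trans wt trho).
have /cvg_normcP Sd := f'E _ zt.
set n := normc (w - z); have n0 : 0 <= n by exact: normc_ge0.
apply/ler_addgt0Pr => e e0.
(* Two errors of this size, and a third one multiplied by [n], add up to [e]. *)
have e3 : 0 < e / (n + 2) by rewrite divr_gt0// ltr_wpDl.
near \oo => N.
have hz : normc (series (fun k => a k * (z - z0) ^+ k) N - f z) < e / (n + 2).
  by near: N; exact: Sz.
have hw : normc (series (fun k => a k * (w - z0) ^+ k) N - f w) < e / (n + 2).
  by near: N; exact: Sw.
have hd : normc (series (da z) N - f' z) < e / (n + 2).
  by near: N; exact: Sd.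
set sz := series _ N in hz; set sw := series _ N in hw; set sd := series _ N in hd.
have hs : normc (sw - sz - sd * (w - z)) <= 2 * M / t ^+ 2 * n ^+ 2.
  have -> : sw - sz - sd * (w - z) = \sum_(0 <= k < N) a k *
      ((w - z0) ^+ k - (z - z0) ^+ k - k%:R * (z - z0) ^+ k.-1 * ((w - z0) - (z - z0))).
    rewrite /sw /sz /sd /series /= -sumrB mulr_suml -sumrB; apply: eq_bigr => k _.
    by rewrite /da; ring.
  have t2 : 0 < t ^+ 2 by rewrite exprn_gt0.
  apply: le_trans (normc_sum _ _) _; rewrite -(ler_pM2l t2) mulr_sumr.
  apply: (@le_trans _ _ (\sum_(0 <= k < N) (M * n ^+ 2) * 2^-1 ^+ k)); last first.
    rewrite -mulr_sumr; apply: le_trans (ler_wpM2l _ (sum_geometric_half_le N)) _.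
      by rewrite mulr_ge0 ?sqr_ge0.
    rewrite le_eqVlt; apply/orP; left; apply/eqP; field.
    by rewrite gt_eqF.
  apply: ler_sum => k _; rewrite ComplexField.Normc.normcM mulrCA.
  apply: le_trans (ler_wpM2l (normc_ge0 _) (exprB_quad_bound _ (ltW zt) (ltW wt))) _.
  rewrite (_ : w - z0 - (z - z0) = w - z); last ring.
  rewrite -/n mulrA [X in _ <= X]mulrAC ler_wpM2r ?sqr_ge0//.
rewrite [X in normc X](_ : _ = (sw - sz - sd * (w - z)) +
   ((sz - f z) - (sw - f w) + (sd - f' z) * (w - z))); last ring.
apply: le_trans (le_normcD _ _) _; apply: lerD => //.
apply: le_trans (le_normcD _ _) _.
apply: le_trans (lerD (normcB_le _ _) (lexx _)) _.
rewrite ComplexField.Normc.normcM -/n.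
have -> : e = e / (n + 2) + e / (n + 2) + e / (n + 2) * n.
  by field; rewrite gt_eqF// ltr_wpDl.
by apply: lerD; [apply: lerD; exact: ltW|rewrite ler_wpM2r// ltW].
Unshelve. all: by end_near. Qed.

(** Comparing both expansions at [z0 + s] bounds |f1 z0 - f2 z0| by (M1 + M2) s for all small s > 0.
    Uniqueness is what allows local derivatives to be glued. *)
Lemma quad_diff_derivative_unique f f1 f2 z0 :
  quad_diff f f1 z0 -> quad_diff f f2 z0 -> f1 z0 = f2 z0.
Proof.
move=> [d1 [M1 [d10 M10 fM1]]] [d2 [M2 [d20 M20 fM2]]].
apply/eqP; rewrite -subr_eq0 -normc_eq0; apply/eqP/le_anti.
rewrite normc_ge0 andbT; apply/ler_addgt0Pr => e e0; rewrite add0r.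
set M := M1 + M2 + 1; have M0 : 0 < M by rewrite /M; lra.
set s := Num.min (Num.min d1 d2 / 2) (e / M).
have s0 : 0 < s by rewrite lt_min !divr_gt0// lt_min d10.
have sm : s <= Num.min d1 d2 / 2 by rewrite /s ge_min lexx.
have sE : s <= e / M by rewrite /s ge_min lexx orbT.
have [m1 m2] : Num.min d1 d2 <= d1 /\ Num.min d1 d2 <= d2 by rewrite !ge_min !lexx orbT.
have mp : 0 < Num.min d1 d2 by rewrite lt_min d10.
have nE : normc (z0 + s%:C - z0) = s by rewrite [z0 + _]addrC addrK normc_real gtr0_norm.
have z0z0 d : 0 < d -> normc (z0 - z0) < d by rewrite subrr ComplexField.Normc.normc0.
have h1 : normc (f (z0 + s%:C) - f z0 - f1 z0 * (z0 + s%:C - z0)) <= M1 * s ^+ 2.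
  by rewrite -{3}nE; apply: fM1; rewrite ?z0z0// nE; lra.
have h2 : normc (f (z0 + s%:C) - f z0 - f2 z0 * (z0 + s%:C - z0)) <= M2 * s ^+ 2.
  by rewrite -{3}nE; apply: fM2; rewrite ?z0z0// nE; lra.
rewrite -(ler_pM2r s0) -[in X in _ * X <= _]nE -ComplexField.Normc.normcM.
rewrite [X in normc X](_ : _ =
  (f (z0 + s%:C) - f z0 - f2 z0 * (z0 + s%:C - z0)) -
  (f (z0 + s%:C) - f z0 - f1 z0 * (z0 + s%:C - z0))); last ring.
apply: le_trans (normcB_le _ _) _; apply: le_trans (lerD h2 h1) _.
rewrite ler_pdivlMr// /M in sE; nra.
Qed.

Lemma quad_diff_near f f' z0 : quad_diff f f' z0 ->
  exists2 d, 0 < d & forall z, normc (z - z0) < d -> quad_diff f f' z.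
Proof.
move=> [d [M [d0 M0 fM]]]; exists d => // z zd.
exists (d - normc (z - z0)), M; split => //; first by rewrite subr_gt0.
move=> x y xz yz; apply: fM.
  by rewrite -(subrKA z); apply: le_lt_trans (le_normcD _ _) _; lra.
by rewrite -(subrKA z); apply: le_lt_trans (le_normcD _ _) _; lra.
Qed.

Lemma analytic_near_quad_diff f (A : set R[i]) : analytic_near A f ->
  exists f', forall z, A z -> quad_diff f f' z.
Proof.
move=> [U [oU AU fU]].
have /choice[F FE] : forall z, exists f', U z -> quad_diff f f' z.
  move=> z; have [Uz|nUz] := pselect (U z); last by exists f.
  by have [f' f'z] := analytic_at_quad_diff (fU z Uz); exists f'.
(* Each centre [z0] comes with its own derivative [F z0]; the diagonal glues them, and by uniqueness
   it agrees with [F z0] near [z0]. *)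
exists (fun z => F z z) => z0 /AU Uz0.
have [d1 d10 fd1] := quad_diff_near (FE _ Uz0).
have /nbhs_normcP[d2 d20 Ud2] : nbhs z0 U by exact: open_nbhs_nbhs.
have [d3 [M [d30 M0 fM]]] := FE _ Uz0.
exists (Num.min (Num.min d1 d2) d3), M; split => //; first by rewrite !lt_min d10 d20.
move=> z w; rewrite !lt_min => /andP[/andP[z1 z2] z3] /andP[_ w3].
have -> : F z z = F z0 z.
  by apply: quad_diff_derivative_unique (FE _ (Ud2 _ z2)) (fd1 _ z1).
exact: fM.
Qed.

End power_series.

(** * Cauchy's integral formula *)

Section homotopy.
Variable R : realType.
Implicit Types (s t a b : R).
Local Notation mu := (@lebesgue_measure R).

Lemma integrable_segment_continuous (f : R -> R) a b : continuous f ->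
  mu.-integrable `[a, b] (EFin \o f).
Proof.
move=> cf; apply: continuous_compact_integrable; first exact: segment_compact.
exact: continuous_subspaceT.
Qed.

Lemma Rintegral_derivative_periodic (f F : R -> R) a b : a < b -> continuous f ->
  (forall t, is_derive t 1 F (f t)) -> F a = F b ->
  \int[mu]_(t in `[a, b]) f t = 0.
Proof.
move=> ab cf Ff Fab.
have cF : continuous F.
  by move=> t; apply: differentiable_continuous; apply/derivable1_diffP; apply: ex_derive.
rewrite /Rintegral (@continuous_FTC2 _ f F a b)//.
- by rewrite Fab subee.
- exact: continuous_subspaceT.
- split=> [t _||].
  + exact: ex_derive.
  + exact/cvg_at_right_filter/cF.
  + exact/cvg_at_left_filter/cF.
- by move=> t _; rewrite derive1E; apply: derive_val.
Qed.

(** Differentiation under the integral sign turns the vanishing integrals of [fs] into a zero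
    derivative in [s] on the whole line. *)
Lemma Rintegral_homotopy_const (f fs : R -> R -> R) a b :
  (forall s, continuous (f s)) ->
  (forall s t, is_derive s 1 (f ^~ t) (fs s t)) ->
  continuous (fun p : R * R => fs p.1 p.2) ->
  (forall s, \int[mu]_(t in `[a, b]) fs s t = 0) ->
  forall s1 s2, \int[mu]_(t in `[a, b]) f s1 t = \int[mu]_(t in `[a, b]) f s2 t.
Proof.
move=> cf ffs cfs fs0 s1 s2.
suff F0 (s : R) : is_derive s (1 : R) (fun s => \int[mu]_(t in `[a, b]) f s t) 0.
  exact: (@is_derive_0_is_cst _ (fun s => \int[mu]_(t in `[a, b]) f s t)).
pose I : set R := [set` `]s - 1, s + 1[]; pose J : set R := [set` `[a, b]].
(* Domination near [s]: [fs] is bounded on the compact rectangle [s - 1, s + 1] x [a, b]. *)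
have [M M0 fsM] : exists2 M : R, 0 <= M & forall x t, I x -> J t ->
    `|fs x t| <= M.
  have cK : compact ((fun p : R * R => fs p.1 p.2) @` (`[s - 1, s + 1] `*` `[a, b])).
    apply: continuous_compact; first exact: continuous_subspaceT.
    by apply: compact_setX; exact: segment_compact.
  have [N [_ NM]] := compact_bounded cK.
  exists (`|N| + 1) => // x t xs tab; apply: NM; first by rewrite (le_lt_trans (ler_norm N))// ltrDl.
  exists (x, t) => //; split => //=.
  exact: subset_itv_oo_cc.
have sI : I s by rewrite /I /= in_itv /=; apply/andP; split; lra.
have int_f x : I x -> mu.-integrable `[a, b] (EFin \o f x).
  by move=> _; exact: integrable_segment_continuous.
have der_f x t : I x -> J t -> derivable (f ^~ t) x 1.
  by move=> _ _; exact: ex_derive.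
have fsE x t : partial1of2 f x t = fs x t.
  by rewrite partial1of2E; apply: derive_val.
have int_M : mu.-integrable `[a, b] (EFin \o (fun=> M)).
  by apply: integrable_segment_continuous => ?; exact: cvg_cst.
have ub x t : I x -> J t -> `|partial1of2 f x t| <= M.
  by rewrite fsE; exact: fsM.
apply: DeriveDef.
  exact: (derivable_under_integral (mu := mu) (measurable_itv _) sI int_f der_f (fun=> M0) int_M ub).
rewrite -derive1E (differentiation_under_integral (mu := mu) (measurable_itv _) sI int_f der_f (fun=> M0) int_M ub).
by rewrite -[RHS](fs0 s); apply: eq_Rintegral => t _; exact: fsE.
Qed.

End homotopy.

(** * The parametrised circle and the contraction parameter *)

Section cauchy.
Variable R : realType.
Implicit Types (z w a : R[i]) (r s t : R) (f : R[i] -> R[i]).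
Local Notation mu := (@lebesgue_measure R).
Local Notation circ := (@circle_point R).

Lemma normc_circle_point r t : 0 <= r -> normc (circ r t) = r.
Proof.
move=> r0; rewrite /circle_point /= !exprMn -mulrDr cos2Dsin2 mulr1 sqrtr_sqr.
by rewrite ger0_norm.
Qed.

Lemma circle_point_is_cderive r t : is_cderive (circ r) t ('i * circ r t).
Proof.
split; rewrite /circle_point /=.
  have -> : 0 * (r * cos t) - 1 * (r * sin t) = r *: - sin t.
    by rewrite /GRing.scale /=; ring.
  exact: is_deriveZ.
have -> : 0 * (r * sin t) + 1 * (r * cos t) = r *: cos t.
  by rewrite /GRing.scale /=; ring.
exact: is_deriveZ.
Qed.

Lemma circle_point_continuous r : continuous (circ r).
Proof. by move=> t; apply: is_cderive_continuous (circle_point_is_cderive r t). Qed.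

Lemma circle_point_periodic r : circ r (2 * pi) = circ r 0.
Proof. by rewrite /circle_point mulr_natl cos2pi sin2pi cos0 sin0. Qed.

Lemma Re_continuous : continuous (fun z : R[i] => Re z).
Proof.
have FF (z : R[i]) : Filter (nbhs z) by exact: nbhs_filter.
move=> z; apply/(@cvgrPdist_lt _ _ _ (nbhs z) (FF z)) => e e0; apply/nbhs_normcP; exists e => // w wz.
by apply: le_lt_trans wz; rewrite -ReN -ReD normc_distC normRe_le.
Qed.

Lemma real_complex_continuous : continuous (fun s : R => s%:C).
Proof.
move=> s; apply/(cvg_normcP (F := nbhs s)) => e e0; apply/nbhs_ballP; exists e => // t.
rewrite /ball /= distrC => ts; apply: le_lt_trans ts.
by rewrite -normc_real rmorphB.
Qed.

(* Takes values in [0, 1] for every real s, so that the contraction of the circle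
   is defined on all of R and no one-sided derivative in s occurs. *)
Definition smoothstep s : R := (1 - cos s) / 2.

Lemma smoothstep_is_derive s : is_derive s 1 smoothstep (sin s / 2).
Proof.
have -> : smoothstep = 2^-1 *: (cst 1 - cos).
  by apply/funext => x; rewrite /smoothstep /= mulrC.
by apply: is_derive_eq; rewrite /GRing.scale /= sub0r opprK mulrC.
Qed.

Lemma smoothstep_bounds s : 0 <= smoothstep s <= 1.
Proof.
have := cos_max s; rewrite /smoothstep ler_norml => /andP[h1 h2].
by apply/andP; split; lra.
Qed.

(** At a zero [smoothstep] is minimal, so its derivative vanishes; this settles the values of [s] at
    which one cannot divide by [smoothstep s]. *)
Lemma smoothstep_eq0 s : smoothstep s = 0 -> sin s = 0.
Proof.
rewrite /smoothstep => h; have c1 : cos s = 1 by lra.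
by have := cos2Dsin2 s; rewrite c1 => h2; apply/eqP; rewrite -sqrf_eq0; apply/eqP; lra.
Qed.

End cauchy.

(** * The Cauchy kernel integral *)

Section cauchy_formula.
Variable R : realType.
Implicit Types (z w a : R[i]) (r s t : R) (f : R[i] -> R[i]).
Local Notation mu := (@lebesgue_measure R).
Local Notation circ := (@circle_point R).
Local Notation sm := (@smoothstep R).

Lemma quad_diff_affine (a b z0 : R[i]) : quad_diff (fun z => a + b * z) (fun=> b) z0.
Proof.
exists 1, 0; split => // z w _ _.
rewrite [X in normc X](_ : _ = 0); last ring.
by rewrite ComplexField.Normc.normc0 mul0r.
Qed.

Lemma is_cderive_affine (a b : R[i]) (u : R -> R) s l : is_derive s 1 u l ->
  is_cderive (fun x => a + (u x)%:C * b) s (l%:C * b).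
Proof.
move=> ul.
have uC : is_cderive (fun x => (u x)%:C) s l%:C by split => //=; exact: is_derive_cst.
have := is_cderive_comp (quad_diff_affine a b _) uC.
rewrite mulrC; suff -> : (fun x => a + b * (u x)%:C) = (fun x => a + (u x)%:C * b) by [].
by apply/funext => x; rewrite mulrC.
Qed.

Lemma Re_comp_continuous (T : topologicalType) (u : T -> R[i]) :
  continuous u -> continuous (fun x => Re (u x)).
Proof. by move=> cu x; apply: continuous_comp (cu x) (@Re_continuous R _). Qed.

Section kernel.
Variables (f f' : R[i] -> R[i]) (r : R) (a : R[i]).
Hypotheses (r0 : 0 < r) (ar : normc a < r).
Hypothesis ff' : forall z, normc z <= r -> quad_diff f f' z.

(** Contraction of the circle: [Z 0] is constantly [a] and [Z pi] is the circle. Each [Z s t] is a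
    convex combination of [a] and a point of the circle, hence stays in the disc where [f] is
    differentiable. *)
Let Z s t := a + (sm s)%:C * (circ r t - a).

Let Zr s t : normc (Z s t) <= r.
Proof.
have /andP[s0 s1] := smoothstep_bounds s.
have -> : Z s t = (1 - sm s)%:C * a + (sm s)%:C * circ r t.
  by rewrite /Z rmorphB rmorph1; ring.
apply: le_trans (le_normcD _ _) _.
rewrite !ComplexField.Normc.normcM !normc_real normc_circle_point ?(ltW r0)//.
rewrite !ger0_norm ?subr_ge0//.
have : (1 - sm s) * normc a <= (1 - sm s) * r by rewrite ler_wpM2l ?subr_ge0// ltW.
lra.
Qed.

Let circ_neq t : circ r t - a != 0.
Proof.
rewrite subr_eq0; apply/eqP => ca; move: ar; rewrite -ca normc_circle_point ?(ltW r0)//.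
by rewrite ltxx.
Qed.

Let fc z : normc z <= r -> f w @[w --> z] --> f z.
Proof. by move=> /ff'; exact: quad_diff_continuous. Qed.

Let Z_is_cderive_t s t : is_cderive (Z s) t ((sm s)%:C * ('i * circ r t)).
Proof.
have := is_cderive_comp (quad_diff_affine (a - (sm s)%:C * a) (sm s)%:C _)
   (circle_point_is_cderive r t).
suff -> : Z s = (fun s0 : R => a - (sm s)%:C * a + (sm s)%:C * circ r s0) by [].
by apply/funext => x; rewrite /Z; ring.
Qed.

Lemma kernel_continuous : continuous (fun t => f (circ r t) * (circ r t / (circ r t - a))).
Proof.
move=> t; apply: cvgM.
  apply: continuous_comp; first exact: circle_point_continuous.
  by apply: fc; rewrite normc_circle_point ?(ltW r0).
apply: cvgM; first exact: circle_point_continuous.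
apply: cvgV; first exact: circ_neq.
by apply: cvgB; [exact: circle_point_continuous|exact: cvg_cst].
Qed.

(* Contracting the circle to [a], the [s]-derivative of the integrand is, up to the
   factor [sm' / sm], the [t]-derivative of [Im (f (Z s t))], hence integrates to 0. *)
Lemma Rintegral_kernel :
  \int[mu]_(t in `[0, 2 * pi]) Re (f (circ r t) * (circ r t / (circ r t - a))) =
  \int[mu]_(t in `[0, 2 * pi]) Re (f a * (circ r t / (circ r t - a))).
Proof.
pose F s t := Re (f (Z s t) * (circ r t / (circ r t - a))).
pose D s t := Re (f' (Z s t) * ((sin s / 2)%:C * circ r t)).
have sm0 : sm 0 = 0 by rewrite /smoothstep cos0 subrr mul0r.
have smpi : sm pi = 1 by rewrite /smoothstep cospi; lra.
transitivity (\int[mu]_(t in `[0, 2 * pi]) F pi t).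
  by apply: eq_Rintegral => t _; rewrite /F /Z smpi rmorph1 mul1r [a + _]addrC subrK.
transitivity (\int[mu]_(t in `[0, 2 * pi]) F 0 t); last first.
  by apply: eq_Rintegral => t _; rewrite /F /Z sm0 rmorph0 mul0r addr0.
have cZ : continuous (fun p : R * R => Z p.1 p.2).
  move=> p; apply: cvgD; first exact: cvg_cst.
  apply: cvgM.
    apply: (@continuous_comp _ _ _ (fun p : R * R => sm p.1) (fun x : R => x%:C)).
      apply: (@continuous_comp _ _ _ fst sm); first exact: cvg_fst.
      apply: differentiable_continuous; apply/derivable1_diffP.
      by have h := smoothstep_is_derive p.1; exact: ex_derive.
    exact: real_complex_continuous.
  apply: cvgB; last exact: cvg_cst.
  apply: (@continuous_comp _ _ _ snd (circ r)); first exact: cvg_snd.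
  exact: circle_point_continuous.
apply: (@Rintegral_homotopy_const _ F D).
- move=> s; apply: Re_comp_continuous => t; apply: cvgM.
    apply: (@continuous_comp _ _ _ (Z s) f); last exact/fc/Zr.
    exact: is_cderive_continuous (Z_is_cderive_t s t).
  apply: cvgM; first exact: circle_point_continuous.
  apply: cvgV; first exact: circ_neq.
  by apply: cvgB; [exact: circle_point_continuous|exact: cvg_cst].
- move=> s t; set k := circ r t / (circ r t - a).
  have [+ _] := is_cderive_comp (u := Z ^~ t) (quad_diffM_const k (ff' (Zr s t)))
    (is_cderive_affine a (circ r t - a) (smoothstep_is_derive s)).
  (* The [s]-derivative of [Z] carries the factor [circ r t - a], which cancels the denominator of
     the kernel. *)
  have -> : k * f' (Z s t) * ((sin s / 2)%:C * (circ r t - a)) =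
      f' (Z s t) * ((sin s / 2)%:C * circ r t).
    by rewrite /k; field; exact: circ_neq.
  by under eq_fun do rewrite mulrC.
- apply: Re_comp_continuous => p; apply: cvgM.
    apply: (@continuous_comp _ _ _ (fun p : R * R => Z p.1 p.2) f'); first exact: cZ.
    exact/quad_diff_derivative_continuous/ff'/Zr.
  apply: cvgM.
    apply: (@continuous_comp _ _ _ (fun p : R * R => sin p.1 / 2) (fun x : R => x%:C)).
      apply: cvgM; last exact: cvg_cst.
      apply: (@continuous_comp _ _ _ fst sin); first exact: cvg_fst.
      exact: continuous_sin.
    exact: real_complex_continuous.
  apply: (@continuous_comp _ _ _ snd (circ r)); first exact: cvg_snd.
  exact: circle_point_continuous.
- move=> s; have [s0|s0] := eqVneq (sm s) 0.
    rewrite (_ : \int[mu]_(t in _) _ = \int[mu]_(t in `[0, 2 * pi]) 0).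
      by rewrite Rintegral_cst ?mul0r.
    apply: eq_Rintegral => t _.
    by rewrite /D (smoothstep_eq0 s0) mul0r rmorph0 mul0r mulr0.
  apply: (@Rintegral_derivative_periodic _ (D s)
    (fun t => sin s / 2 / sm s * Im (f (Z s t)))).
  + by rewrite mulr_gt0// pi_gt0.
  + apply: Re_comp_continuous => t; apply: cvgM.
      apply: (@continuous_comp _ _ _ (Z s) f').
        exact: is_cderive_continuous (Z_is_cderive_t s t).
      exact/quad_diff_derivative_continuous/ff'/Zr.
    by apply: cvgM; [exact: cvg_cst|exact: circle_point_continuous].
  + move=> t; have [_ h] := is_cderive_comp (ff' (Zr s t)) (Z_is_cderive_t s t).
    (* Since Im (i w) = Re w, the [t]-derivative of [Im (f (Z s t))] is [sm s] times the real part
       of [f' (Z s t) * circ r t], and [sm s] cancels. *)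
    have -> : D s t = (sin s / 2 / sm s) *: Im (f' (Z s t) * ((sm s)%:C * ('i * circ r t))).
      rewrite /D /GRing.scale /=.
      rewrite (_ : f' _ * (_ * ('i * _)) = (sm s)%:C * ('i * (f' (Z s t) * circ r t))); last ring.
      rewrite mulrCA ReRM ImRM; set w := f' _ * _.
      have -> : Im ('i * w) = Re w by case: (w) => x y /=; ring.
      by rewrite mulrA divfK.
    exact: is_deriveZ.
  + by rewrite /Z circle_point_periodic.
Qed.

End kernel.

Lemma conjc_circle_point r t : 0 < r -> conjc (circ r t) = (r ^+ 2)%:C / circ r t.
Proof.
move=> r0; have c0 : circ r t != 0 by rewrite -normc_gt0 normc_circle_point ?ltW.
apply: (mulIf c0); rewrite divfK//.
have : normc (circ r t) ^+ 2 = r ^+ 2 by rewrite normc_circle_point ?ltW.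
rewrite sqr_normcE => <-; rewrite /circle_point /=.
by apply/eqP; rewrite eq_complex; apply/andP; split; apply/eqP => /=; ring.
Qed.

(** Conjugation preserves real parts and, as the conjugate of z is r^2 / z on the circle, turns z /
    (z - a) into 1 / (1 - b z), which is analytic on the closed disc. Contracting to the centre 0,
    where the kernel is 1, then evaluates the integral. *)
Lemma Rintegral_cauchy_kernel w r a : 0 < r -> normc a < r ->
  \int[mu]_(t in `[0, 2 * pi]) Re (w * (circ r t / (circ r t - a))) = 2 * pi * Re w.
Proof.
move=> r0 ar; pose b := conjc a / (r ^+ 2)%:C.
have circ0 t : circ r t != 0 by rewrite -normc_gt0 normc_circle_point ?ltW.
have bz z : normc z <= r -> 1 - b * z != 0.
  move=> zr; rewrite subr_eq0; apply/eqP => bz1.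
  have : normc (b * z) < 1.
    rewrite !ComplexField.Normc.normcM normcJ_eq ComplexField.Normc.normcV normc_real.
    rewrite ger0_norm ?sqr_ge0// mulrAC ltr_pdivrMr ?exprn_gt0// mul1r expr2.
    by have := normc_ge0 a; have := normc_ge0 z; nra.
  by rewrite -bz1 ComplexField.Normc.normc1 ltxx.
have n00 : normc (0 : R[i]) < r by rewrite ComplexField.Normc.normc0.
have h := Rintegral_kernel r0 n00
  (fun z zr => quad_diffM_const (conjc w) (quad_diff_inv (bz z zr))).
transitivity (\int[mu]_(t in `[0, 2 * pi]) Re ((conjc w) * (1 - b * circ r t)^-1 * (circ r t / (circ r t - 0)))).
  apply: eq_Rintegral => t _.
  rewrite subr0 divff// mulr1.
  symmetry; have -> : forall x : R[i], Re x = Re (conjc x) by case.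
  have conjM (x y : R[i]) : conjc (x * y) = conjc x * conjc y by exact: rmorphM.
  have conjB (x : R[i]) : conjc (1 - x) = 1 - conjc x by rewrite rmorphB rmorph1.
  congr Re; rewrite conjM conjcK conjc_inv conjB 2!conjM conjcK conjc_inv conjc_real.
  rewrite conjc_circle_point//; congr (_ * _).
  have rC0 : r%:C != 0 by rewrite (inj_eq (@complexI R) _ 0) gt_eqF.
  have ca : circ r t - a != 0.
    rewrite subr_eq0; apply/eqP => ca; move: ar.
    by rewrite -ca normc_circle_point ?(ltW r0)// ltxx.
  by field; rewrite ca circ0 rC0.
rewrite h; transitivity (\int[mu]_(t in `[0, 2 * pi]) Re w).
  apply: eq_Rintegral => t _; rewrite subr0 divff// mulr0 subr0 invr1 !mulr1.
  by case: (w).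
have muE : mu [set` `[0, 2 * pi]] = (2 * pi)%:E.
  by rewrite lebesgue_measure_itv /= lte_fin mulr_gt0 ?pi_gt0//= -EFinD subr0.
by rewrite Rintegral_cst// [RHS]mulrC; congr (_ * _); exact: (congr1 fine muE).
Qed.

End cauchy_formula.

(** * Critical points *)

Section logarithmic_derivative.
Variable F : fieldType.
Implicit Types (xs : seq F) (z : F).

Definition poly_of_roots xs : {poly F} := \prod_(x <- xs) ('X - x%:P).
(** The logarithmic derivative of [poly_of_roots xs]; [inv_sqr_sum xs] is minus its derivative. *)
Definition inv_sum xs z := \sum_(x <- xs) (z - x)^-1.
Definition inv_sqr_sum xs z := \sum_(x <- xs) (z - x)^-1 ^+ 2.

Lemma poly_of_roots_neq0 xs z : z \notin xs -> (poly_of_roots xs).[z] != 0.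
Proof. by move=> zxs; have := root_prod_XsubC xs z; rewrite (negbTE zxs) /root => ->. Qed.

(** With A and B the two sums, p' = A p and A' = -B give p'' = (A^2 - B) p. One induction proves
    both, since the second derivative of (X - x) q contains q'. *)
Lemma deriv_poly_of_roots xs z : z \notin xs ->
  (poly_of_roots xs)^`().[z] = (poly_of_roots xs).[z] * inv_sum xs z /\
  (poly_of_roots xs)^`()^`().[z] =
    (poly_of_roots xs).[z] * (inv_sum xs z ^+ 2 - inv_sqr_sum xs z).
Proof.
rewrite /poly_of_roots /inv_sum /inv_sqr_sum.
elim: xs => [_|x xs IH]; first by rewrite !big_nil derivC deriv0 !hornerE; split; ring.
rewrite inE negb_or => /andP[zx /IH[]]; rewrite !big_cons.
set q := \prod_(_ <- xs) _; set A := \sum_(_ <- xs) _; set B := \sum_(_ <- xs) _ => q1 q2.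
have zx0 : z - x != 0 by rewrite subr_eq0.
rewrite derivM derivXsubC mul1r derivD derivM derivXsubC mul1r.
by split; rewrite !(hornerXsubC, hornerD, hornerM) q1 ?q2; field.
Qed.

End logarithmic_derivative.

(** * Location of the critical points and bounds on logarithmic derivatives *)

Section critical_point_estimates.
Variable R : realType.
Implicit Types (x z w : R[i]) (r s C eps : R) (xs : seq R[i]).

(** The map u -> 1 / (1 - u) sends the closed unit disc without 1 to the half-plane of real part at
    least 1/2; here u = x / z. In coordinates this reduces to |x|^2 <= |z|^2. *)
Lemma Re_div_sub_ge_half x z : z != x -> normc x <= normc z -> 2^-1 <= Re (z / (z - x)).
Proof.
move=> zx xz; have zx0 : 0 < normc (z - x) by rewrite normc_gt0 subr_eq0.
have x2z2 : normc x ^+ 2 <= normc z ^+ 2 by rewrite lerXn2r ?nnegrE ?normc_ge0.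
have -> : Re (z / (z - x)) = Re (z * conjc (z - x)) / normc (z - x) ^+ 2.
  rewrite sqr_normcE; case: (z) (x) => a b [c d] /=; rewrite /GRing.inv /=; ring.
rewrite ler_pdivlMr ?exprn_gt0//; move: x2z2; rewrite !sqr_normcE.
by case: (z) (x) => a b [c d] /=; lra.
Qed.

(** The terms z / (z - x) all have real part at least 1/2, so they cannot cancel, and the real part
    of their sum bounds its modulus from below. *)
Lemma inv_sum_ge xs z r : 0 < r -> (forall x, x \in xs -> normc x < r) -> r <= normc z ->
  (size xs)%:R / 2 <= normc z * normc (inv_sum xs z).
Proof.
move=> r0 xsr rz; rewrite -ComplexField.Normc.normcM; apply: le_trans (Re_le_normc _).
rewrite /inv_sum mulr_sumr Re_sum.
elim: xs xsr => [|x xs IH] xsr; first by rewrite big_nil mul0r.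
have xr : normc x < normc z by apply: lt_le_trans rz; apply: xsr; rewrite inE eqxx.
rewrite big_cons /= -natr1 mulrDl mul1r addrC; apply: lerD.
  by apply: Re_div_sub_ge_half; [apply: contraTneq xr => ->; rewrite ltxx|exact: ltW].
by apply: IH => y yxs; apply: xsr; rewrite inE yxs orbT.
Qed.

Lemma notin_outside xs z r : (forall x, x \in xs -> normc x < r) -> r <= normc z ->
  z \notin xs.
Proof. by move=> xsr rz; apply/negP => /xsr; rewrite ltNge rz. Qed.

Lemma deriv_poly_of_roots_neq0 xs z r : 0 < r -> xs != [::] ->
  (forall x, x \in xs -> normc x < r) -> r <= normc z ->
  (poly_of_roots xs)^`().[z] != 0.
Proof.
move=> r0 xs0 xsr rz; have zxs := notin_outside xsr rz.
rewrite (deriv_poly_of_roots zxs).1 mulf_neq0 ?poly_of_roots_neq0//.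
have := inv_sum_ge r0 xsr rz; apply: contraTneq => ->.
rewrite ComplexField.Normc.normc0 mulr0 -ltNge divr_gt0// ltr0n lt0n size_eq0//.
Qed.

Lemma critical_pointsE (p : {poly R[i]}) :
  p^`() = lead_coef p^`() *: poly_of_roots (critical_points p).
Proof. by rewrite /critical_points; case: (closed_field_poly_normal _). Qed.

(* Gauss-Lucas *)
Lemma critical_points_bounded xs w r : 0 < r -> xs != [::] ->
  (forall x, x \in xs -> normc x < r) ->
  w \in critical_points (poly_of_roots xs) -> normc w < r.
Proof.
move=> r0 xs0 xsr wcp; rewrite ltNge; apply/negP => rw.
have /negP := deriv_poly_of_roots_neq0 r0 xs0 xsr rw; apply.
have := root_prod_XsubC (critical_points (poly_of_roots xs)) w; rewrite wcp /root => cw0.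
by rewrite critical_pointsE hornerZ mulf_eq0 cw0 orbT.
Qed.

(** The first sum is the logarithmic derivative of p', so it equals p'' / p' = (A^2 - B) / A = A - B
    / A. *)
Lemma inv_sum_critical_points xs z r : 0 < r -> xs != [::] ->
  (forall x, x \in xs -> normc x < r) -> r <= normc z ->
  inv_sum (critical_points (poly_of_roots xs)) z - inv_sum xs z =
  - (inv_sqr_sum xs z / inv_sum xs z).
Proof.
move=> r0 xs0 xsr rz; set p := poly_of_roots xs; set ws := critical_points p.
have dp0 := deriv_poly_of_roots_neq0 r0 xs0 xsr rz.
have zws : z \notin ws.
  by apply: (@notin_outside ws z r) => // w; exact: critical_points_bounded.
have zxs := notin_outside xsr rz.
have [d1 d2] := deriv_poly_of_roots zxs.
have p0 := poly_of_roots_neq0 zxs.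
have A0 : inv_sum xs z != 0 by move: dp0; rewrite d1 mulf_eq0 negb_or => /andP[].
have : p^`()^`().[z] = p^`().[z] * inv_sum ws z.
  by rewrite (critical_pointsE p) derivZ !hornerZ (deriv_poly_of_roots zws).1 mulrA.
rewrite -/p in d1 d2 p0; rewrite d1 d2 -mulrA => /(mulfI p0) e.
by apply: (mulfI A0); rewrite mulrBr -e; field.
Qed.

(** Each root is at distance at least [eps] from [z], so |B| <= n / eps^2, while |A| >= n / (2 (C +
    eps)); the number n of roots cancels in B / A. *)
Lemma inv_sum_critical_points_le xs z C eps : 0 < C -> 0 < eps -> xs != [::] ->
  (forall x, x \in xs -> normc x < C) -> normc z = C + eps ->
  normc (inv_sum (critical_points (poly_of_roots xs)) z - inv_sum xs z) <=
  2 * (C + eps) / eps ^+ 2.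
Proof.
move=> C0 eps0 xs0 xsC zE.
have Cz : C <= normc z by rewrite zE; lra.
rewrite (inv_sum_critical_points C0 xs0 xsC Cz) normcN ComplexField.Normc.normcM.
rewrite ComplexField.Normc.normcV.
have n0 : 0 < ((size xs)%:R : R) by rewrite ltr0n lt0n size_eq0.
have Age := inv_sum_ge C0 xsC Cz; rewrite zE in Age.
have A0 : 0 < normc (inv_sum xs z).
  rewrite -(pmulr_rgt0 _ (_ : 0 < C + eps)) ?addr_gt0//.
  by apply: lt_le_trans Age; rewrite divr_gt0.
have Ble : normc (inv_sqr_sum xs z) <= (size xs)%:R / eps ^+ 2.
  apply: le_trans (normc_sum _ _) _.
  rewrite -sum1_size natr_sum mulr_suml big_seq [leRHS]big_seq; apply: ler_sum => x xxs.
  rewrite normcXn ComplexField.Normc.normcV mul1r exprVn lef_pV2 ?posrE ?exprn_gt0//; last first.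
    by rewrite normc_gt0 subr_eq0; apply: contraNneq (notin_outside xsC Cz) => ->.
  rewrite lerXn2r ?nnegrE ?normc_ge0 ?(ltW eps0)//.
  have := le_normcD (z - x) x; rewrite subrK zE; have := xsC _ xxs; lra.
rewrite ler_pdivrMr//; apply: le_trans Ble _.
rewrite mulrAC ler_wpM2r ?invr_ge0 ?sqr_ge0//.
by rewrite -mulrA; lra.
Qed.

End critical_point_estimates.

(** * Comparison of the sums over critical points and over roots *)

Section main_estimate.
Variable R : realType.
Implicit Types (x z w : R[i]) (r s t C eps : R) (xs ws : seq R[i]) (f : R[i] -> R[i]).
Local Notation mu := (@lebesgue_measure R).
Local Notation circ := (@circle_point R).

Lemma cauchy_formula_Re f f' r a : 0 < r -> normc a < r ->
  (forall z, normc z <= r -> quad_diff f f' z) ->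
  \int[mu]_(t in `[0, 2 * pi]) Re (f (circ r t) * (circ r t / (circ r t - a))) =
  2 * pi * Re (f a).
Proof.
move=> r0 ar ff'; rewrite (Rintegral_kernel r0 ar ff').
exact: Rintegral_cauchy_kernel.
Qed.

(** Continuity is carried through the induction because splitting off one point requires
    integrability of the remaining sum. *)
Lemma cauchy_formula_sum f f' r ws : 0 < r -> (forall w, w \in ws -> normc w < r) ->
  (forall z, normc z <= r -> quad_diff f f' z) ->
  continuous (fun t => Re (f (circ r t) * (circ r t * inv_sum ws (circ r t)))) /\
  \int[mu]_(t in `[0, 2 * pi]) Re (f (circ r t) * (circ r t * inv_sum ws (circ r t))) =
  2 * pi * Re (\sum_(w <- ws) f w).
Proof.
move=> r0 + ff'; elim: ws => [_|w ws IH wsr].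
  have E t : Re (f (circ r t) * (circ r t * inv_sum [::] (circ r t))) = 0.
    by rewrite /inv_sum big_nil !mulr0.
  split; first by under eq_fun do rewrite E; move=> t; exact: cvg_cst.
  transitivity (\int[mu]_(t in `[0, 2 * pi]) (0 : R)).
    by apply: eq_Rintegral => t _; exact: E.
  by rewrite Rintegral_cst ?mul0r// big_nil mulr0.
have [|c1 i1] := IH; first by move=> x xws; apply: wsr; rewrite inE xws orbT.
have wr : normc w < r by apply: wsr; rewrite inE eqxx.
have c2 := Re_comp_continuous (kernel_continuous r0 wr ff').
have E t : Re (f (circ r t) * (circ r t * inv_sum (w :: ws) (circ r t))) =
    Re (f (circ r t) * (circ r t / (circ r t - w))) +
    Re (f (circ r t) * (circ r t * inv_sum ws (circ r t))).
  by rewrite -ReD /inv_sum big_cons !mulrDr.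
split.
  by under eq_fun do rewrite E; move=> t; apply: cvgD; [exact: c2|exact: c1].
transitivity (\int[mu]_(t in `[0, 2 * pi])
    (Re (f (circ r t) * (circ r t / (circ r t - w))) +
     Re (f (circ r t) * (circ r t * inv_sum ws (circ r t))))).
  by apply: eq_Rintegral => t _; exact: E.
rewrite RintegralD//; first last.
- exact: integrable_segment_continuous.
- exact: integrable_segment_continuous.
by rewrite i1 (cauchy_formula_Re r0 wr ff') big_cons ReD [RHS]mulrDr.
Qed.

(** Cauchy's formula for [u * f] at both families of points writes 2 pi |S| as the integral of a
    function bounded by 2 r / eps^2 times |f| r, where the last factor is the modulus of the point
    on the circle. Division by 2 pi gives the constant. *)
Lemma sum_critical_points_le f f' C eps xs : 0 < C -> 0 < eps -> xs != [::] ->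
  (forall x, x \in xs -> normc x < C) ->
  (forall z, normc z <= C + eps -> quad_diff f f' z) ->
  normc (\sum_(w <- critical_points (poly_of_roots xs)) f w - \sum_(x <- xs) f x) <=
  (C + eps) / (pi * eps ^+ 2) * circle_abs_integral (C + eps) f.
Proof.
move=> C0 eps0 xs0 xsC ff'; set r := C + eps; set ws := critical_points _.
have r0 : 0 < r by rewrite addr_gt0.
have pi2 : 0 < 2 * pi :> R by rewrite mulr_gt0// pi_gt0.
set S := _ - _; have [u u1 ->] := exists_unimodular S.
have guf' z : normc z <= r -> quad_diff (fun z => u * f z) (fun z => u * f' z) z.
  by move=> zr; exact: quad_diffM_const (ff' z zr).
have wsr w : w \in ws -> normc w < r.
  by move=> /(critical_points_bounded C0 xs0 xsC) wC; rewrite (lt_trans wC)// ltrDl.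
have xsr x : x \in xs -> normc x < r.
  by move=> /xsC xC; rewrite (lt_trans xC)// ltrDl.
have [c1 i1] := cauchy_formula_sum r0 wsr guf'.
have [c2 i2] := cauchy_formula_sum r0 xsr guf'.
have cf : continuous (fun t => normc (f (circ r t)) * r).
  (* The modulus is rewritten through the [R[i]]-valued norm, whose continuity is then available. *)
  have -> : (fun t => normc (f (circ r t)) * r) = (fun t => Re (`|f (circ r t)| * r%:C)).
    by apply/funext => t; rewrite normr_normc [_ * r%:C]mulrC ReRM mulrC.
  apply: Re_comp_continuous => t; apply: cvgM; last exact: cvg_cst.
  apply: (@continuous_comp _ _ _ (fun t => f (circ r t)) Num.norm).
    apply: (@continuous_comp _ _ _ (circ r) f); first exact: circle_point_continuous.
    by apply/quad_diff_continuous/ff'; rewrite normc_circle_point ?(ltW r0).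
  exact: norm_continuous.
rewrite -(ler_pM2l pi2).
have -> : 2 * pi * Re (u * S) = \int[mu]_(t in `[0, 2 * pi])
    (Re (u * f (circ r t) * (circ r t * inv_sum ws (circ r t))) -
     Re (u * f (circ r t) * (circ r t * inv_sum xs (circ r t)))).
  rewrite RintegralB//; first last.
  - exact: integrable_segment_continuous.
  - exact: integrable_segment_continuous.
  by rewrite i1 i2 -[RHS]mulrBr -ReN -ReD /S [in LHS]mulrBr !mulr_sumr.
have -> : 2 * pi * (r / (pi * eps ^+ 2) * circle_abs_integral r f) =
    \int[mu]_(t in `[0, 2 * pi]) (2 * r / eps ^+ 2 * (normc (f (circ r t)) * r)).
  rewrite RintegralZl//; last exact: integrable_segment_continuous.
  rewrite /circle_abs_integral mulrA; congr (_ * _).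
  by move: (pi_gt0 R); move: (pi : R) => q q0; field; rewrite !gt_eqF.
apply: le_Rintegral => //.
- apply: integrable_segment_continuous => t; apply: cvgB; [exact: c1|exact: c2].
- by apply: integrable_segment_continuous => t; apply: cvgM; [exact: cvg_cst|exact: cf].
move=> t _; rewrite -ReN -ReD -mulrBr -mulrBr; apply: le_trans (Re_le_normc _) _.
rewrite !ComplexField.Normc.normcM u1 mul1r normc_circle_point ?(ltW r0)//.
rewrite mulrA mulrC ler_wpM2r ?mulr_ge0 ?normc_ge0 ?(ltW r0)//.
by apply: inv_sum_critical_points_le => //; rewrite normc_circle_point ?(ltW r0).
Qed.

End main_estimate.

(** * Almost sure location of the random points *)

Section random_points.
Variable R : realType.

Lemma closure_ball_normc (r : R) (z : R[i]) : 0 < r -> normc z <= r ->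
  closure (ball (0 : R[i]) r%:C) z.
Proof.
move=> r0 zr B /nbhs_normcP[e e0 zB].
(* Scaling by [1 - d] moves a point of the closed disc into the open one; [d <= 2^-1] keeps the
   factor positive, and the other bound keeps the displacement below [e]. *)
pose d := Num.min (2^-1) (e / (2 * r)).
have d0 : 0 < d by rewrite lt_min invr_gt0 ltr0n divr_gt0// mulr_gt0.
have d1 : d <= 2^-1 by rewrite /d ge_min lexx.
have de : d <= e / (2 * r) by rewrite /d ge_min lexx orbT.
rewrite ler_pdivlMr ?mulr_gt0// in de.
have z0 := normc_ge0 z.
exists ((1 - d)%:C * z); split.
  rewrite ball_normc sub0r normcN ComplexField.Normc.normcM normc_real.
  by rewrite ger0_norm; [nra|lra].
apply: zB; rewrite (_ : _ - z = (- d)%:C * z); last by rewrite !rmorphD rmorphN rmorph1; ring.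
rewrite ComplexField.Normc.normcM normc_real normrN gtr0_norm//; nra.
Qed.

Lemma measurable_ball_complex (x : R[i]) (r : R) : measurable (ball x r%:C).
Proof.
apply: sub_sigma_algebra; rewrite openE => y.
rewrite ball_normc => yr; apply/nbhs_normcP.
exists (r - normc (x - y)) => [|z zy]; first by rewrite subr_gt0.
rewrite ball_normc -(subrKA y); apply: le_lt_trans (le_normcD _ _) _.
by rewrite [normc (y - z)]normc_distC; lra.
Qed.

(** Each event has probability [mu A], that is 1, because [X i] has law [mu]; countably many null
    sets have a null union. *)
Lemma ae_in_full_measure (d d' : measure_display) (T : measurableType d)
    (T' : measurableType d') (P : probability T R) (mu : probability T' R)
    (X : nat -> {RV P >-> T'}) (A : set T') :
  measurable A -> mu A = 1%E -> iid_with_law mu X ->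
  {ae P, forall omega, forall i, A (X i omega)}.
Proof.
move=> mA muA [_ Xmu]; apply/ae_foralln => i.
have mXA : measurable (X i @^-1` A) by rewrite -[_ @^-1` _]setTI; exact: measurable_funP.
exists (~` (X i @^-1` A)); split; first exact: measurableC.
  transitivity (1 - P (X i @^-1` A))%E; first exact: probability_setC.
  have -> : P (X i @^-1` A) = 1%E by rewrite -[LHS]/(distribution P (X i) A) Xmu.
  by rewrite subee.
by [].
Qed.

End random_points.

Unset Implicit Arguments.
Set Strict Implicit.

Theorem theorem2p18 (R : realType) (C c eps : R)
    (hC : 0 < C) (hc : 0 < c) (heps : 0 < eps) :
  exists K : R, 0 < K /\
  forall (mu : probability R[i] R),
    mu (ball (0 : R[i]) C%:C) = 1%E ->
    (forall z : R[i], boundary (ball (0 : R[i]) (C + eps)%:C) z ->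
       c%:C <= `|cauchy_stieltjes mu z|) ->
  forall (d : measure_display) (T : measurableType d) (P : probability T R)
    (X : nat -> {RV P >-> R[i]}),
    iid_with_law mu X ->
  forall phi : nat -> R[i] -> R[i],
    (forall n, analytic_near (closure (ball (0 : R[i]) (C + eps)%:C)) (phi n)) ->
  {ae P, forall omega, forall n : nat, K < n%:R ->
    `| \sum_(w <- critical_points (\prod_(i < n) ('X - (X i omega)%:P))) phi n w
       - \sum_(i < n) phi n (X i omega) |
    <= (K * circle_abs_integral (C + eps) (phi n))%:C}.
Proof.
have r0 : 0 < C + eps by rewrite addr_gt0.
(* The constant of the deterministic estimate, fixed before [mu], [X] and [phi]. *)
exists ((C + eps) / (pi * eps ^+ 2)); split.
  by rewrite divr_gt0// mulr_gt0 ?pi_gt0 ?exprn_gt0.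
move=> mu muC _ d T P X Xmu phi phiA.
(* Off a single null set all points lie in the disc of radius [C]; the rest is deterministic and
   holds for every [n] at once. *)
apply: filterS (ae_in_full_measure (measurable_ball_complex 0 C) muC Xmu).
(* A positive constant below [n%:R] excludes [n = 0], for which the list of roots would be empty. *)
move=> omega XC n Kn; have n0 : (0 < n)%N.
  rewrite -(ltr0n R); apply: lt_trans Kn.
  by rewrite divr_gt0// mulr_gt0 ?pi_gt0 ?exprn_gt0.
have [f' ff'] := analytic_near_quad_diff (phiA n).
have {}ff' z : normc z <= C + eps -> quad_diff (phi n) f' z.
  by move=> zr; apply/ff'/closure_ball_normc.
pose xs := [seq X (nat_of_ord i) omega | i <- index_enum 'I_n].
have xs0 : xs != [::].
  have : X 0%N omega \in xs.
    by apply/mapP; exists (Ordinal n0); rewrite ?mem_index_enum.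
  by case: xs.
have xsC x : x \in xs -> normc x < C.
  by move=> /mapP[i _ ->]; have := XC i; rewrite ball_normc sub0r normcN.
have := sum_critical_points_le hC heps xs0 xsC ff'.
by rewrite /poly_of_roots /xs !big_map -lecR.
Qed.
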